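(* Let $m_1,m_2\in\mathbb{N}$, $m=\operatorname{lcm}(m_1,m_2)$ and $a_1,a_2\in\mathbb{Z}$, and put $E_{(a_1,a_2)}(m_1,m_2)=\frac1m\sum_{k=1}^m c_{m_1}(k-a_1)c_{m_2}(k-a_2)$. Then $$E_{(a_1,a_2)}(m_1,m_2)=\sum_{\substack{d_1\mid m_1,\ d_2\mid m_2\\ \gcd(d_1,d_2)\mid a_1-a_2}}\gcd(d_1,d_2)\mu(m_1/d_1)\mu(m_2/d_2).$$ Furthermore, if $|a_1-a_2|=1$, then $$E_{(a_1,a_2)}(m_1,m_2)=\begin{cases}(-1)^{\omega(m)}, & \text{if } m_1=m_2=m \text{ is squarefree},\\ 0,&\text{otherwise}.\end{cases}$$
   Context: For $n\in\mathbb{N}$ and $k\in\mathbb{Z}$, $c_n(k)=\sum_{1\le j\le n,\ \gcd(j,n)=1}\exp(2\pi i jk/n)$ is the Ramanujan sum. $\mu$ is the Möbius function and $\omega(m)$ is the number of distinct prime factors of $m$. *)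

(* Defs.v *)
From mathcomp Require Export all_boot all_order all_algebra.
From mathcomp Require Export reals sequences exp trigo.
From mathcomp Require Export complex.

Set Implicit Arguments.
Unset Strict Implicit.
Unset Printing Implicit Defensive.

Import Order.TTheory GRing.Theory Num.Theory.

Local Open Scope ring_scope.

(* exp (x + i y) = e^x (cos y + i sin y) *)
Definition cexp (R : realType) (z : R[i]) : R[i] :=
  (expR (complex.Re z))%:C%C * (cos (complex.Im z) +i* sin (complex.Im z))%C.

Definition ramanujan_sum (R : realType) (n : nat) (k : int) : R[i] :=
  \sum_(1 <= j < n.+1 | coprime j n)
    cexp (2 * (pi : R)%:C%C * 'i%C * j%:R * k%:~R / n%:R).

(* Every d with d ^ 2 %| n and n > 0 is at most n; squarefree 0 = false since 0 ^ 2 %| 0. *)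
Definition squarefree (n : nat) : bool :=
  [forall d : 'I_n.+1, ((d : nat) ^ 2 %| n)%N ==> ((d : nat) == 1%N)].

Definition omega (n : nat) : nat := size (primes n).

Definition mobius (n : nat) : int :=
  if squarefree n then (-1) ^+ omega n else 0.

Definition E2 (R : realType) (a1 a2 : int) (m1 m2 : nat) : R[i] :=
  let m := lcmn m1 m2 in
  m%:R^-1 * \sum_(1 <= k < m.+1)
    ramanujan_sum R m1 (k%:Z - a1) * ramanujan_sum R m2 (k%:Z - a2).

(* Main.v *)
Require Import Defs.
From mathcomp Require Import all_boot all_order all_algebra.
From mathcomp Require Import reals sequences exp trigo complex.
From mathcomp Require Import ring lra zify.

(** Mobius inversion of the coprimality condition, together with the vanishing
    of sums of nontrivial roots of unity, gives
    [c_n(k) = \sum_(d | n, d | k) d mu(n / d)].  Expanding both factors of [E]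
    leaves the density of the [k] with [k = a1 mod d1] and [k = a2 mod d2]; by
    the Chinese remainder theorem it is [1 / lcm(d1, d2)] if
    [gcd(d1, d2) | a1 - a2] and [0] otherwise.
    For the second claim, the sum over [k] is carried out directly on the
    exponentials: only pairs of reduced fractions with [j1 / m1 + j2 / m2]
    integral survive, which forces [m1 = m2], so that [E] is
    [c_m1(a2 - a1)] if [m1 = m2] and [0] otherwise; and [c_n(1)] and [c_n(-1)]
    both equal [mu(n)]. *)

Set Implicit Arguments.
Unset Strict Implicit.
Unset Printing Implicit Defensive.

Import Order.TTheory GRing.Theory Num.Theory.

Local Open Scope ring_scope.

(** * Mobius function *)

(** If [d ^ 2] divides [n] with [d > 1], so does the square of the least prime factor of [d]; the
    case [d = 0] is excluded by [0 < n]. *)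
Lemma squarefree_primeP (n : nat) : (0 < n)%N ->
  reflect (forall p, prime p -> ~~ (p ^ 2 %| n)%N) (squarefree n).
Proof.
move=> n0; apply: (iffP forallP) => [sf p pp | h d].
  apply/negP => dv.
  have pn : (p < n.+1)%N by rewrite ltnS dvdn_leq// (dvdn_trans _ dv)// dvdn_exp.
  by have := sf (Ordinal pn); rewrite /= dv /= => /eqP p1; rewrite p1 in pp.
apply/implyP => dv; apply: contraTT dv => d1.
have [d0|d0] := posnP d; first by rewrite d0 exp0n// dvd0n -lt0n.
have dgt1 : (1 < d)%N by rewrite ltn_neqAle eq_sym d1.
apply: contra (h _ (pdiv_prime dgt1)) => dv.
by rewrite (dvdn_trans _ dv)// dvdn_exp2r// pdiv_dvd.
Qed.

Lemma squarefree_gt0 (n : nat) : squarefree n -> (0 < n)%N.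
Proof.
by case: n => // /forallP /(_ ord0).
Qed.

Lemma squarefreeM (p e : nat) : prime p -> ~~ (p %| e)%N -> (0 < e)%N ->
  squarefree (p * e) = squarefree e.
Proof.
move=> pp pe e0; have p0 := prime_gt0 pp.
have pe0 : (0 < p * e)%N by rewrite muln_gt0 p0.
apply/(squarefree_primeP pe0)/(squarefree_primeP e0) => h q pq.
  by apply: contra (h q pq) => qe; rewrite dvdn_mull.
have [->|qp] := eqVneq q p; first by rewrite -mulnn dvdn_pmul2l.
rewrite Gauss_dvdr ?h// coprimeXl// prime_coprime//.
by rewrite dvdn_prime2.
Qed.

Lemma mobius1 : mobius 1 = 1.
Proof.
rewrite /mobius ifT//; apply/squarefree_primeP => // p pp.
by rewrite dvdn1 -(exp1n 2) eqn_exp2r//; apply: contraTneq pp => ->.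
Qed.

Lemma mobiusM_prime (p e : nat) : prime p -> ~~ (p %| e)%N -> (0 < e)%N ->
  mobius (p * e) = - mobius e.
Proof.
move=> pp pe e0; rewrite /mobius squarefreeM//.
case: ifP => _; rewrite ?oppr0// /omega.
have /perm_size -> : perm_eq (primes (p * e)) (p :: primes e).
  apply: uniq_perm; rewrite ?primes_uniq//= ?primes_uniq ?andbT.
    by rewrite mem_primes (negbTE pe) !andbF.
  by move=> q; rewrite primesM ?(prime_gt0 pp)// primes_prime// !inE.
by rewrite /= exprS mulN1r.
Qed.

Lemma mobiusM_dvd (p e : nat) : prime p -> (p %| e)%N -> (0 < e)%N ->
  mobius (p * e) = 0.
Proof.
move=> pp pe e0; rewrite /mobius ifF//; apply/negbTE/negP.
move=> /[dup]/squarefree_gt0 pe0 /(squarefree_primeP pe0)/(_ p pp)/negP; apply.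
by rewrite -mulnn dvdn_pmul2l// prime_gt0.
Qed.

Lemma perm_divisors_prime (p n : nat) : prime p -> (0 < n)%N -> (p %| n)%N ->
  perm_eq [seq d <- divisors n | (p %| d)%N]
          [seq (p * e)%N | e <- divisors (n %/ p)].
Proof.
move=> pp n0 pn; have p0 := prime_gt0 pp.
have np0 : (0 < n %/ p)%N by rewrite divn_gt0// dvdn_leq.
apply: uniq_perm; first by rewrite filter_uniq// divisors_uniq.
  rewrite map_inj_uniq ?divisors_uniq// => x y /eqP.
  by rewrite eqn_pmul2l// => /eqP.
move=> d; rewrite mem_filter -dvdn_divisors//.
apply/andP/mapP => [[/dvdnP[e ->]] epn|[e]].
  exists e; last by rewrite mulnC.
  by rewrite -dvdn_divisors// -(@dvdn_pmul2r p)// divnK.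
rewrite -dvdn_divisors// => en ->; split; first exact: dvdn_mulr.
by rewrite mulnC -(divnK pn) dvdn_pmul2r.
Qed.

(** Fix a prime [p] dividing [n > 1]. Divisors [p * e] with [p] dividing [e] contribute 0, and those
    with [e] prime to [p] cancel against the divisors [e] of [n] prime to [p]. *)
Lemma sum_mobius (n : nat) : (0 < n)%N ->
  \sum_(d <- divisors n) mobius d = (n == 1%N)%:R.
Proof.
move=> n0; have [->|n1] := eqVneq n 1%N; first by rewrite big_seq1 mobius1.
have pp : prime (pdiv n) by rewrite pdiv_prime// ltn_neqAle eq_sym n1.
have pn := pdiv_dvd n; move: (pdiv n) pp pn => p pp pn.
have p0 := prime_gt0 pp.
have np0 : (0 < n %/ p)%N by rewrite divn_gt0// dvdn_leq.
rewrite (bigID (fun d => p %| d)%N) /= -big_filter.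
rewrite (perm_big _ (perm_divisors_prime pp n0 pn)) big_map.
rewrite (bigID (fun d => p %| d)%N) /= big_seq_cond big1 ?add0r.
  rewrite [X in _ + X](_ : _ = \sum_(e <- divisors (n %/ p) | ~~ (p %| e)%N) mobius e).
    rewrite -big_split /= big_seq_cond big1// => e /andP[].
    rewrite -dvdn_divisors// => /(dvdn_gt0 np0) e0 pe.
    by rewrite mobiusM_prime// addNr.
  (* A divisor of [n] prime to [p] already divides [n %/ p], so both sums have the same terms. *)
  rewrite -[LHS]big_filter -[RHS]big_filter; apply: perm_big.
  apply: uniq_perm; rewrite ?filter_uniq ?divisors_uniq// => e.
  rewrite !mem_filter -!dvdn_divisors//; have [//|pe] := boolP (p %| e)%N => /=.
  by rewrite -[in LHS](divnK pn) Gauss_dvdl// coprime_sym prime_coprime.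
move=> e /andP[]; rewrite -dvdn_divisors// => /(dvdn_gt0 np0) e0 pe.
exact: mobiusM_dvd.
Qed.

Lemma coprime_mobius (j n : nat) : (0 < n)%N ->
  (coprime j n)%:R = \sum_(d <- divisors n | (d %| j)%N) mobius d.
Proof.
move=> n0; have g0 : (0 < gcdn j n)%N by rewrite gcdn_gt0 n0 orbT.
rewrite /coprime -(sum_mobius g0) -[RHS]big_filter; apply: perm_big; apply: uniq_perm.
- exact: divisors_uniq.
- by rewrite filter_uniq// divisors_uniq.
by move=> d; rewrite mem_filter -!dvdn_divisors// dvdn_gcd.
Qed.

Lemma sum_multiples (V : nmodType) (F : nat -> V) (n d : nat) :
  (0 < n)%N -> (d %| n)%N ->
  \sum_(1 <= j < n.+1 | (d %| j)%N) F j = \sum_(1 <= j < (n %/ d).+1) F (d * j)%N.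
Proof.
move=> n0 dn; have d0 := dvdn_gt0 n0 dn.
rewrite -[RHS](big_map (muln d) predT) -[LHS]big_filter; apply: perm_big; apply: uniq_perm.
- by rewrite filter_uniq// iota_uniq.
- rewrite map_inj_uniq ?iota_uniq// => x y /eqP.
  by rewrite eqn_pmul2l// => /eqP.
move=> j; rewrite mem_filter mem_index_iota ltnS.
apply/andP/mapP => [[/dvdnP[q ->]] /andP[q0 qn]|[q]].
  exists q; last by rewrite mulnC.
  rewrite mem_index_iota ltnS leq_divRL// qn andbT.
  by move: q0; rewrite muln_gt0 => /andP[].
rewrite mem_index_iota ltnS leq_divRL// => /andP[q0 qn] ->.
by rewrite dvdn_mulr// muln_gt0 d0 q0 mulnC.
Qed.

Lemma perm_divisors_compl (n : nat) : (0 < n)%N ->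
  perm_eq (divisors n) [seq (n %/ d)%N | d <- divisors n].
Proof.
move=> n0; have sub : {in divisors n, forall d, (n %/ (n %/ d) = d)%N}.
  by move=> d; rewrite -dvdn_divisors// => dn; rewrite divnA// mulKn.
apply: uniq_perm; first exact: divisors_uniq.
  rewrite map_inj_in_uniq ?divisors_uniq// => x y xn yn xy.
  by rewrite -(sub x)// xy sub.
move=> d; apply/idP/mapP => [dn|[e]].
  by exists (n %/ d)%N; rewrite ?sub// -dvdn_divisors// dvdn_div// dvdn_divisors.
by rewrite -!dvdn_divisors// => en ->; rewrite dvdn_div.
Qed.

(** The indicator of coprimality is expanded by [coprime_mobius] and the sums are exchanged. Passing
    to the complementary divisor gives the inner sum length [d], so that it becomes a complete sum
    over [d]-th roots of unity in [ramanujan_sumE]. *)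
Lemma sum_coprime (A : nzRingType) (F : nat -> A) (n : nat) : (0 < n)%N ->
  \sum_(1 <= j < n.+1 | coprime j n) F j =
  \sum_(d <- divisors n)
    (mobius (n %/ d))%:~R * \sum_(1 <= j < d.+1) F (n %/ d * j)%N.
Proof.
move=> n0.
transitivity (\sum_(d <- divisors n)
   (mobius d)%:~R * \sum_(1 <= j < (n %/ d).+1) F (d * j)%N); last first.
  rewrite (perm_big _ (perm_divisors_compl n0)) big_map.
  apply: eq_big_seq => d; rewrite -dvdn_divisors// => dn.
  by rewrite divnA// mulKn.
transitivity (\sum_(1 <= j < n.+1) \sum_(d <- divisors n)
    if (d %| j)%N then (mobius d)%:~R * F j else 0).
  rewrite big_mkcond; apply: eq_bigr => j _; rewrite -big_mkcond -big_distrl /=.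
  rewrite -rmorph_sum -coprime_mobius//.
  by case: coprime; rewrite /= ?mul1r ?mul0r.
rewrite exchange_big; apply: eq_big_seq => d.
rewrite -dvdn_divisors// => dn.
by rewrite -big_mkcond -big_distrr sum_multiples.
Qed.

(** * Roots of unity *)

Section UnitCircle.
Variable R : realType.

Definition cis (x : R) : R[i] := (cos x +i* sin x)%C.

Lemma cis0 : cis 0 = 1.
Proof. by rewrite /cis cos0 sin0. Qed.

Lemma cisD (x y : R) : cis (x + y) = cis x * cis y.
Proof.
rewrite /cis cosD sinD; apply/eqP; rewrite eq_complex /=.
by rewrite eqxx /= addrC.
Qed.

Lemma cis_neq0 (x : R) : cis x != 0.
Proof.
have h : cis x * cis (- x) = 1 by rewrite -cisD subrr cis0.
apply: contra_eq_neq h => ->; by rewrite mul0r eq_sym oner_neq0.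
Qed.

Lemma cisMz (x : R) (t : int) : cis (x * t%:~R) = cis x ^ t.
Proof.
have nat_case (n : nat) : cis (x * n%:R) = cis x ^+ n.
  elim: n => [|n IHn]; first by rewrite mulr0 cis0.
  by rewrite -natr1 mulrDr mulr1 cisD IHn exprSr.
case: t => n; first exact: nat_case.
rewrite NegzE mulrNz -invr_expz -exprnP -nat_case mulrN.
apply: (mulIf (cis_neq0 (x * n.+1%:R))).
by rewrite -cisD addNr cis0 mulVf ?cis_neq0.
Qed.

Lemma cis_2pi : cis (2 * pi) = 1.
Proof. by rewrite /cis mulrC mulr_natr cos2pi sin2pi. Qed.

(** The real parts differ: [1 - cos x] is twice the square of [sin (x / 2)], and [x / 2] lies
    strictly between 0 and [pi]. *)
Lemma cis_neq1 (x : R) : 0 < x < 2 * pi -> cis x != 1.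
Proof.
move=> /andP[x0 x2]; rewrite eq_complex /= negb_and; apply/orP; left.
have : 0 < sin (x / 2) by apply: sin_gt0_pi; lra.
have -> : cos x = 1 - 2 * sin (x / 2) ^+ 2.
  by rewrite {1}(splitr x) cosD -!expr2 cos2sin2; ring.
by move=> s0; rewrite lt_eqF//; nra.
Qed.

Definition zeta (n : nat) : R[i] := cis (2 * pi / n%:R).

Lemma zeta_neq0 n : zeta n != 0.
Proof. exact: cis_neq0. Qed.

Lemma zeta_expn (q n : nat) : (0 < q)%N -> zeta (q * n) ^+ q = zeta n.
Proof.
move=> q0; rewrite exprnP /zeta -cisMz; congr cis.
have q0R : (q%:R : R) != 0 by rewrite pnatr_eq0 -lt0n.
by rewrite natrM invfM -pmulrn [q%:R^-1 * _]mulrC mulrA mulfVK.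
Qed.

Lemma zeta_expz_eq1 (n : nat) (t : int) : (0 < n)%N ->
  (zeta n ^ t == 1) = (n %| t)%Z.
Proof.
move=> n0.
have nR : (n%:R : R) != 0 by rewrite pnatr_eq0 -lt0n.
have zn : zeta n ^ n = 1.
  by rewrite /zeta -cisMz mulfVK// cis_2pi.
apply/eqP/dvdzP => [zt|[q ->]]; last first.
  by rewrite [q * _]mulrC -exprz_exp zn exp1rz.
(* It remains to see that the remainder [r] of [t] vanishes. The [r]-th power of [zeta n] is 1,
   whereas [0 < r < n] would put its angle strictly between 0 and [2 * pi]. *)
exists (t %/ n)%Z; rewrite {1}(divz_eq t n).
have : zeta n ^ (t %% n)%Z = 1.
  rewrite -zt [in RHS](divz_eq t n) [RHS]expfzDr ?zeta_neq0//.
  by rewrite (mulrC _ n%:Z) -exprz_exp zn exp1rz mul1r.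
have : (0 <= (t %% n)%Z) by rewrite modz_ge0// -lt0n.
have : (t %% n)%Z < n by rewrite ltz_pmod.
case: (t %% n)%Z => // -[|r] rn _; first by rewrite addr0.
rewrite /zeta -cisMz => /eqP; apply: contraTeq => _; apply: cis_neq1.
have p0 := pi_gt0 R.
have n0R : 0 < (n%:R : R) by rewrite ltr0n.
rewrite mulrAC -pmulrn divr_gt0 ?mulr_gt0 ?ltr0n//= ltr_pdivrMr//.
by rewrite ltr_pM2l ?mulr_gt0// ltr_nat.
Qed.

End UnitCircle.

Lemma cexp_zeta (R : realType) (n j : nat) (k : int) :
  cexp (2 * (pi : R)%:C%C * 'i%C * j%:R * k%:~R / n%:R) = zeta R n ^ (j%:Z * k).
Proof.
rewrite /zeta -cisMz.
set x := 2 * pi / n%:R * (j%:Z * k)%:~R.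
have -> : 2 * (pi : R)%:C%C * 'i%C * j%:R * k%:~R / n%:R = (0 +i* x)%C.
  have -> : (0 +i* x)%C = x%:C%C * 'i%C :> R[i].
    by apply/eqP; rewrite eq_complex /= !(mulr0, mul0r, mulr1, subr0, addr0) !eqxx.
  rewrite /x !rmorphM /= fmorphV /= !rmorph_nat !rmorph_int /=; ring.
by rewrite /cexp /= expR0 rmorph1 mul1r.
Qed.

(** * Ramanujan sums *)

Lemma sum_root_unity (F : fieldType) (z : F) (n : nat) : z ^+ n = 1 ->
  \sum_(1 <= k < n.+1) z ^+ k = if z == 1 then n%:R else 0.
Proof.
move=> zn; case: eqVneq => [->|z1].
  by under eq_bigr do rewrite expr1n; rewrite sumr_const_nat subSS subn0.
apply: (mulfI (_ : z - 1 != 0)); first by rewrite subr_eq0.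
rewrite mulr0 big_add1 /= big_mkord.
under eq_bigr do rewrite exprS.
by rewrite -big_distrr /= mulrCA -subrX1 zn subrr mulr0.
Qed.

(** Orthogonality of additive characters modulo [n]. The range may be any multiple of [n], because
    [count_congr] sums up to a multiple of its modulus. *)
Lemma sum_zeta (R : realType) (n m : nat) (t : int) : (0 < n)%N -> (n %| m)%N ->
  \sum_(1 <= k < m.+1) zeta R n ^ (k%:Z * t) =
  if (n %| t)%Z then m%:R else 0.
Proof.
move=> n0 nm; rewrite -(zeta_expz_eq1 R t n0) -sum_root_unity.
  by apply: eq_bigr => k _; rewrite mulrC -exprz_exp.
apply/eqP; rewrite exprnP exprz_exp zeta_expz_eq1//.
by rewrite dvdz_mull.
Qed.

Lemma ramanujan_sum_zeta (R : realType) (n : nat) (k : int) :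
  ramanujan_sum R n k = \sum_(1 <= j < n.+1 | coprime j n) zeta R n ^ (j%:Z * k).
Proof. by apply: eq_bigr => j _; rewrite cexp_zeta. Qed.

(** After [sum_coprime], the power [n %/ d] of [zeta n] is [zeta d], so each inner sum is evaluated
    by [sum_zeta]. *)
Lemma ramanujan_sumE (R : realType) (n : nat) (k : int) : (0 < n)%N ->
  ramanujan_sum R n k =
  \sum_(d <- divisors n | (d %| k)%Z) d%:R * (mobius (n %/ d))%:~R.
Proof.
move=> n0; rewrite ramanujan_sum_zeta sum_coprime// [RHS]big_mkcond.
apply: eq_big_seq => d; rewrite -dvdn_divisors// => dn.
have d0 := dvdn_gt0 n0 dn.
have q0 : (0 < n %/ d)%N by rewrite divn_gt0// dvdn_leq.
rewrite (eq_bigr (fun j : nat => zeta R d ^ (j%:Z * k))) => [|j _].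
  by rewrite sum_zeta//; case: ifP; rewrite ?mulr0// mulrC.
by rewrite PoszM -mulrA -exprz_exp -exprnP -{1}(divnK dn) zeta_expn.
Qed.

(** * Counting solutions of one and of two congruences *)

Lemma count_congr (R : realType) (L m : nat) (x : int) : (0 < L)%N -> (L %| m)%N ->
  \sum_(1 <= k < m.+1 | (L %| k%:Z - x)%Z) 1 = m%:R / L%:R :> R[i].
Proof.
move=> L0 Lm; have LR : (L%:R : R[i]) != 0 by rewrite pnatr_eq0 -lt0n.
rewrite big_mkcond /=; apply: (mulIf LR); rewrite mulfVK// big_distrl /=.
(* [L] times the indicator of the congruence is expanded into additive characters modulo [L]. *)
transitivity (\sum_(1 <= k < m.+1) \sum_(1 <= j < L.+1)
    zeta R L ^ (- (j%:Z * x)) * zeta R L ^ (k%:Z * j%:Z)).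
  apply: eq_bigr => k _.
  transitivity (if (L %| k%:Z - x)%Z then L%:R else 0 : R[i]).
    by case: ifP; rewrite ?mul1r ?mul0r.
  rewrite -sum_zeta//; apply: eq_bigr => j _.
  by rewrite -expfzDr ?zeta_neq0//; congr (_ ^ _); ring.
(* As [j] runs from 1 to [L], the trivial character is the last one, [j = L]; every other sum over
   [k] vanishes. *)
rewrite exchange_big /= big_nat_recr//= big_nat big1 ?add0r => [|j /andP[j0 jL]].
  rewrite -big_distrr /= sum_zeta// dvdzz.
  have /eqP -> : zeta R L ^ (- (L%:Z * x)) == 1.
    by rewrite zeta_expz_eq1// -mulrN dvdz_mulr.
  by rewrite mul1r.
rewrite -big_distrr /= sum_zeta// ifF ?mulr0//.
by apply/negP => /(dvdn_leq j0); rewrite leqNgt jL.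
Qed.

Lemma chinese_dvdz (d1 d2 : nat) (a1 a2 : int) : ((gcdn d1 d2)%:Z %| a1 - a2)%Z ->
  exists x : int, forall k : int,
    ((d1 %| k - a1) && (d2 %| k - a2) = (lcmn d1 d2 %| k - x))%Z.
Proof.
move=> /dvdzP[t at_]; have [u [v uv]] := Bezoutz d1 d2.
(* Since [u * d1 + v * d2] is the gcd and [a1 - a2] is [t] times it, this witness also equals
   [a2 + v * t * d2], hence solves both congruences. *)
exists (a1 - d1%:Z * u * t) => k; rewrite dvdz_lcm.
have e1 : k - (a1 - d1%:Z * u * t) = k - a1 + u * t * d1%:Z by ring.
have e2 : k - (a1 - d1%:Z * u * t) = k - a2 + (- v * t) * d2%:Z.
  have -> : a1 = a2 + t * (u * d1%:Z + v * d2%:Z) by rewrite uv -at_; ring.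
  by ring.
by congr (_ && _); [rewrite e1|rewrite e2]; rewrite [RHS]rpredDr ?dvdz_mull.
Qed.

Lemma count_congr2 (R : realType) (d1 d2 m : nat) (a1 a2 : int) :
  (0 < d1)%N -> (0 < d2)%N -> (lcmn d1 d2 %| m)%N ->
  \sum_(1 <= k < m.+1 | ((d1 %| k%:Z - a1) && (d2 %| k%:Z - a2))%Z) 1 =
  (if ((gcdn d1 d2)%:Z %| a1 - a2)%Z then m%:R / (lcmn d1 d2)%:R else 0) :> R[i].
Proof.
move=> d10 d20 Lm; case: ifPn => [/chinese_dvdz[x hx]|ng].
  by under eq_bigl do rewrite hx; rewrite count_congr// lcmn_gt0 d10.
rewrite big_pred0// => k; apply: contraNF ng => /andP[h1 h2].
have -> : a1 - a2 = (k%:Z - a2) - (k%:Z - a1) by ring.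
by rewrite rpredB//; apply: dvdz_trans (h1) || apply: dvdz_trans (h2);
  rewrite dvdzE /= ?dvdn_gcdl ?dvdn_gcdr.
Qed.

(** * The two evaluations of [E2] *)

Lemma E2_mobius (R : realType) (m1 m2 : nat) (a1 a2 : int) :
  (0 < m1)%N -> (0 < m2)%N ->
  E2 R a1 a2 m1 m2 =
     \sum_(d1 <- divisors m1)
       \sum_(d2 <- divisors m2 | ((gcdn d1 d2)%:Z %| a1 - a2)%Z)
         (gcdn d1 d2)%:R * (mobius (m1 %/ d1))%:~R * (mobius (m2 %/ d2))%:~R.
Proof.
move=> m10 m20; rewrite /E2 /=; set m := lcmn m1 m2.
have m0 : (0 < m)%N by rewrite lcmn_gt0 m10.
transitivity (\sum_(d1 <- divisors m1) \sum_(d2 <- divisors m2)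
  m%:R^-1 * ((d1%:R * (mobius (m1 %/ d1))%:~R) * (d2%:R * (mobius (m2 %/ d2))%:~R) *
   \sum_(1 <= k < m.+1 | ((d1 %| k%:Z - a1) && (d2 %| k%:Z - a2))%Z) 1 : R[i])).
  transitivity (m%:R^-1 * \sum_(1 <= k < m.+1)
    \sum_(d1 <- divisors m1) \sum_(d2 <- divisors m2)
    ((d1%:R * (mobius (m1 %/ d1))%:~R) * (d2%:R * (mobius (m2 %/ d2))%:~R) *
      if ((d1 %| k%:Z - a1) && (d2 %| k%:Z - a2))%Z then 1 else 0 : R[i])).
    congr (_ * _); apply: eq_bigr => k _; rewrite !ramanujan_sumE//.
    rewrite big_mkcond [X in _ * X]big_mkcond big_distrl /=.
    apply: eq_bigr => d1 _; rewrite big_distrr /=; apply: eq_bigr => d2 _.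
    by do 2 case: ifP => _ /=; rewrite ?(mulr0, mul0r, mulr1).
  rewrite exchange_big big_distrr /=; apply: eq_bigr => d1 _.
  rewrite exchange_big big_distrr /=; apply: eq_bigr => d2 _.
  by rewrite -big_distrr /= -big_mkcond.
apply: eq_big_seq => d1; rewrite -dvdn_divisors// => d1m.
rewrite [RHS]big_mkcond; apply: eq_big_seq => d2; rewrite -dvdn_divisors// => d2m.
have d10 := dvdn_gt0 m10 d1m; have d20 := dvdn_gt0 m20 d2m.
rewrite count_congr2//; last first.
  by rewrite dvdn_lcm (dvdn_trans d1m (dvdn_lcml _ _)) (dvdn_trans d2m (dvdn_lcmr _ _)).
case: ifP => _; last by rewrite !mulr0.
have mR : (m%:R : R[i]) != 0 by rewrite pnatr_eq0 -lt0n.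
have LR : ((lcmn d1 d2)%:R : R[i]) != 0 by rewrite pnatr_eq0 -lt0n lcmn_gt0 d10.
(* The weight [d1 * d2] times the density [1 / lcm] is the gcd. *)
have := congr1 (fun x : nat => x%:R : R[i]) (muln_lcm_gcd d1 d2).
rewrite /= !natrM mulrC => LG.
set u := _%:~R; set v := _%:~R.
transitivity (d1%:R * d2%:R / (lcmn d1 d2)%:R * u * v).
  by field; rewrite mR LR.
by rewrite -LG mulfK.
Qed.

(* If [j1 / m1 + j2 / m2] is an integer and [j1 / m1] is reduced, then [m1 | m2]:
   this is the statement after clearing the common denominator [m]. *)
Lemma dvdn_of_dvd_cross (m1 m2 q1 q2 j1 j2 m : nat) : (0 < m)%N ->
  m = (q1 * m1)%N -> m = (q2 * m2)%N -> coprime j1 m1 ->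
  (m %| q1 * j1 + q2 * j2)%N -> (m1 %| m2)%N.
Proof.
move=> m0 e1 e2 cj dv.
have q0 : (0 < q1)%N by move: m0; rewrite e1 muln_gt0 => /andP[].
(* After multiplication by [m2] the second term is [m * j2] and drops out; cancelling [q1] leaves
   [m1] dividing [m2 * j1]. *)
have : (m %| m2 * (q1 * j1 + q2 * j2))%N by rewrite dvdn_mull.
rewrite mulnDr (mulnA m2 q2) (mulnC m2 q2) -e2.
rewrite dvdn_addl; last by rewrite dvdn_mulr.
by rewrite e1 mulnCA dvdn_pmul2l// Gauss_dvdl// coprime_sym.
Qed.

Lemma E2_orthogonal (R : realType) (m1 m2 : nat) (a1 a2 : int) :
  (0 < m1)%N -> (0 < m2)%N ->
  E2 R a1 a2 m1 m2 = if m1 == m2 then ramanujan_sum R m1 (a2 - a1) else 0.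
Proof.
move=> m10 m20; rewrite /E2 /=; set m := lcmn m1 m2.
have m0 : (0 < m)%N by rewrite lcmn_gt0 m10.
have mR : (m%:R : R[i]) != 0 by rewrite pnatr_eq0 -lt0n.
have [/dvdnP[q1 e1] /dvdnP[q2 e2]] : (m1 %| m)%N /\ (m2 %| m)%N.
  by rewrite dvdn_lcml dvdn_lcmr.
have q10 : (0 < q1)%N by move: m0; rewrite e1 muln_gt0 => /andP[].
have q20 : (0 < q2)%N by move: m0; rewrite e2 muln_gt0 => /andP[].
have z1 : zeta R m1 = zeta R m ^ q1 by rewrite -exprnP e1 zeta_expn.
have z2 : zeta R m2 = zeta R m ^ q2 by rewrite -exprnP e2 zeta_expn.
(* Both roots are powers of [zeta R m], so averaging over [k] leaves the indicator that
   [j1 / m1 + j2 / m2] is an integer. *)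
transitivity (\sum_(1 <= j1 < m1.+1 | coprime j1 m1)
   \sum_(1 <= j2 < m2.+1 | coprime j2 m2)
   if (m %| q1 * j1 + q2 * j2)%N then
     zeta R m1 ^ (- (j1%:Z * a1)) * zeta R m2 ^ (- (j2%:Z * a2)) else 0).
  transitivity (m%:R^-1 * \sum_(1 <= k < m.+1)
     \sum_(1 <= j1 < m1.+1 | coprime j1 m1) \sum_(1 <= j2 < m2.+1 | coprime j2 m2)
       (zeta R m1 ^ (- (j1%:Z * a1)) * zeta R m2 ^ (- (j2%:Z * a2)) *
        zeta R m ^ (k%:Z * (q1 * j1 + q2 * j2)%N%:Z))).
    congr (_ * _); apply: eq_bigr => k _; rewrite !ramanujan_sum_zeta.
    rewrite big_distrl /=; apply: eq_bigr => j1 _.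
    rewrite big_distrr /=; apply: eq_bigr => j2 _.
    rewrite z1 z2 !exprz_exp -!expfzDr ?zeta_neq0//; congr (_ ^ _).
    by rewrite PoszD !PoszM; ring.
  rewrite exchange_big big_distrr /=; apply: eq_bigr => j1 _.
  rewrite exchange_big big_distrr /=; apply: eq_bigr => j2 _.
  rewrite -big_distrr /= sum_zeta// dvdzE /=.
  by case: ifP => _; rewrite ?mulr0// mulrC mulfK.
case: eqVneq => [e12|ne]; last first.
  apply: big1 => j1 c1; apply: big1 => j2 c2; rewrite ifN//.
  apply: contra ne => dv; rewrite eqn_dvd (dvdn_of_dvd_cross m0 e1 e2 c1 dv).
  by rewrite addnC in dv; rewrite (dvdn_of_dvd_cross m0 e2 e1 c2 dv).
subst m2; have em : m = m1 by apply/lcmn_idPl.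
have q11 : q1 = 1%N by move: e1; rewrite em; nia.
have q21 : q2 = 1%N by move: e2; rewrite em; nia.
rewrite em q11 q21 ramanujan_sum_zeta [LHS]big_nat_cond [RHS]big_nat_cond.
apply: eq_bigr => j /andP[/andP[j0]]; rewrite ltnS => jm cj.
(* The representative of [- j] between 1 and [m1]; reducing [j] first keeps it positive when
   [j = m1], which occurs for [m1 = 1]. *)
pose j' := (m1 - j %% m1)%N.
have jlt : (j %% m1 < m1)%N by rewrite ltn_mod.
have dj : (m1 %| 1 * j + 1 * j')%N.
  by rewrite !mul1n {1}(divn_eq j m1) -addnA subnKC ?(ltnW jlt)// dvdn_add// dvdn_mull.
have cj' : coprime j' m1.
  have gj := dvdn_gcdl j' m1; have gm := dvdn_gcdr j' m1.
  rewrite /coprime -dvdn1 -(eqP cj) dvdn_gcd gm andbT -(dvdn_addl j gj).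
  by rewrite (dvdn_trans gm)//; move: dj; rewrite !mul1n.
have j'b : (0 < j' <= m1)%N by rewrite /j'; lia.
rewrite big_mkcond (bigD1_seq j') ?iota_uniq ?mem_index_iota ?ltnS//=.
rewrite cj' dj big1_seq ?addr0 => [|i /andP[ij]].
  (* As [m1] divides [j + j'], the exponent [- j' * a2] may be replaced by [j * a2]. *)
  have /eqP zj : zeta R m1 ^ (- ((1 * j + 1 * j')%N%:Z * a2)) == 1.
    by rewrite zeta_expz_eq1// -mulrN dvdz_mulr.
  rewrite -[RHS]mulr1 -zj -!expfzDr ?zeta_neq0//; congr (_ ^ _).
  by rewrite !mul1n PoszD; ring.
rewrite mem_index_iota ltnS => /andP[i0 im]; case: ifP => // _.
case: ifP => // di; case/eqP: ij.
move: di dj; rewrite !mul1n => /dvdnP[q eq] /dvdnP[q' eq'].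
(* Both [i] and [j'] lie between 1 and [m1], so they differ by less than [m1]; unequal quotients
   would force a difference of at least [m1]. *)
have [lt|gt|e] := ltngtP q q'.
- have : (q.+1 * m1 <= q' * m1)%N by rewrite leq_mul2r lt orbT.
  by rewrite mulSn; lia.
- have : (q'.+1 * m1 <= q * m1)%N by rewrite leq_mul2r gt orbT.
  by rewrite mulSn; lia.
by subst q; lia.
Qed.

(** Only [d = 1] divides a unit, so a single term of [ramanujan_sumE] survives. *)
Lemma ramanujan_sum_norm1 (R : realType) (n : nat) (k : int) :
  (0 < n)%N -> `|k| = 1 -> ramanujan_sum R n k = (mobius n)%:~R.
Proof.
move=> n0 k1; have {}k1 : absz k = 1%N by apply/eqP; rewrite -eqz_nat abszE k1.
rewrite ramanujan_sumE// -big_filter.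
rewrite [X in \sum_(_ <- X) _](_ : _ = [:: 1%N]).
  by rewrite big_seq1 mul1r divn1.
have : perm_eq [seq d <- divisors n | (d%:Z %| k)%Z] [:: 1%N].
  apply: uniq_perm; rewrite ?filter_uniq ?divisors_uniq// => d.
  rewrite mem_filter -dvdn_divisors// dvdzE k1 dvdn1 inE /=.
  by case: eqP => // ->; rewrite dvd1n.
by move/perm_small_eq; apply.
Qed.

Theorem corollary3 (R : realType) (m1 m2 : nat) (a1 a2 : int)
    (m1_gt0 : (0 < m1)%N) (m2_gt0 : (0 < m2)%N) :
  let m := lcmn m1 m2 in
  (E2 R a1 a2 m1 m2 =
     \sum_(d1 <- divisors m1)
       \sum_(d2 <- divisors m2 | ((gcdn d1 d2)%:Z %| a1 - a2)%Z)
         (gcdn d1 d2)%:R * (mobius (m1 %/ d1))%:~R * (mobius (m2 %/ d2))%:~R)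
  /\
  (`|a1 - a2| = 1 ->
     E2 R a1 a2 m1 m2 =
       if [&& m1 == m2, m2 == m & squarefree m] then (-1) ^+ omega m else 0).
Proof.
move=> m; split=> [|a12]; first exact: E2_mobius.
rewrite E2_orthogonal//; case: eqVneq => //= e12; subst m2.
have -> : m = m1 by apply/lcmn_idPl.
rewrite eqxx ramanujan_sum_norm1 1?distrC// /mobius.
by case: ifP => _ //; rewrite rmorphXn rmorphN1.
Qed.
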